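(* Let $a,b\in\mathbb{R}$, let $f:\mathbb{N}_a\cap{_{b}\mathbb{N}}\to\mathbb{R}$ and let $f^*:\mathbb{N}_{-b}\cap{_{-a}\mathbb{N}}\to\mathbb{R}$, $f^*(t)=f(-t)$, be its symmetric dual. Let $n\geq 1$ be an integer, $n-1<\alpha\leq n$, and put $a(\alpha)=a+n-1$. Then for every $t\in\mathbb{N}_{a+n}\cap{_{b}\mathbb{N}}$, $$({^{C}\nabla_{a(\alpha)}^{\alpha}}f)(t)=({^{C}_{-a(\alpha)}\nabla^{\alpha}}f^* )(-t).$$
   Context: For real $a,b$: $\mathbb{N}_a=\{a,a+1,\ldots\}$, ${_{b}\mathbb{N}}=\{b,b-1,\ldots\}$. $\rho(t)=t-1$. $\Delta f(t)=f(t+1)-f(t)$, $\nabla f(t)=f(t)-f(t-1)$, with iterates $\Delta^n,\nabla^n$, and ${_{\circleddash}\Delta^n}=(-1)^n\Delta^n$. Rising function: $t^{\overline{\alpha}}=\Gamma(t+\alpha)/\Gamma(t)$ for $t\notin\{\ldots,-2,-1,0\}$, $0^{\overline{\alpha}}=0$. For $\beta>0$, nabla left fractional sum starting from $c$ and nabla right fractional sum ending at $d$: $$\nabla_c^{-\beta}h(t)=\frac{1}{\Gamma(\beta)}\sum_{s=c+1}^{t}(t-\rho(s))^{\overline{\beta-1}}h(s),\qquad {_{d}\nabla^{-\beta}}h(t)=\frac{1}{\Gamma(\beta)}\sum_{s=t}^{d-1}(s-\rho(t))^{\overline{\beta-1}}h(s);$$ for $\beta=0$ both operators are the identity. For $n-1<\alpha\leq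 n$, the nabla left and right Caputo fractional differences are defined, with $a(\alpha)=a+n-1$ and $b(\alpha)=b-n+1$, by $${^{C}\nabla_{a(\alpha)}^{\alpha}}f(t)=\nabla_{a(\alpha)}^{-(n-\alpha)}(\nabla^n f)(t)\quad(t\in\mathbb{N}_{a+n}),\qquad {^{C}_{b(\alpha)}\nabla^{\alpha}}f(t)={_{b(\alpha)}\nabla^{-(n-\alpha)}}({_{\circleddash}\Delta^n}f)(t)\quad(t\in{_{b-n}\mathbb{N}}).$$ In particular ${^{C}_{-a(\alpha)}\nabla^{\alpha}}f^*$ is the right difference with $b$ replaced by $-a$, since $-a-n+1=-a(\alpha)$. For functions defined only on a finite set of points, these are considered at those $t$ for which all values occurring are defined. *)

(* Defs.v *)
From HB Require Import structures.
From mathcomp Require Import all_boot all_order all_algebra.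
From mathcomp Require Import all_classical all_reals all_analysis.

Set Implicit Arguments.
Unset Strict Implicit.
Unset Printing Implicit Defensive.

Import Order.TTheory GRing.Theory Num.Theory.

Local Open Scope classical_set_scope.
Local Open Scope ring_scope.

Definition upN (R : realType) (a : R) : set R :=
  [set t | exists k : nat, t = a + k%:R].

Definition downN (R : realType) (b : R) : set R :=
  [set t | exists k : nat, t = b - k%:R].

(* Functions on subsets of R are represented by total functions; only the
   values on the intended domain are constrained or used. Accordingly both f
   and fs are arbitrary outside their respective domains here. *)
Definition symmetric_dual (R : realType) (a b : R) (f fs : R -> R) : Prop :=
  forall t, (upN (- b) `&` downN (- a)) t -> fs t = f (- t).

Definition rho (R : realType) (t : R) : R := t - 1.

Definition Delta (R : realType) (f : R -> R) (t : R) : R := f (t + 1) - f t.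

Definition nabla (R : realType) (f : R -> R) (t : R) : R := f t - f (t - 1).

Definition ominus_Delta (R : realType) (n : nat) (f : R -> R) (t : R) : R :=
  (-1) ^+ n * iter n (@Delta R) f t.

(* Euler's integral, meaningful for 0 < x. *)
Definition Gamma_integral (R : realType) (x : R) : R :=
  Rintegral (@lebesgue_measure R) `]0, +oo[
    (fun u => u `^ (x - 1) * expR (- u)).

(* For x <= 0, Gamma x = Gamma (x + k) / (x (x + 1) ... (x + k - 1)), where k
   is the least natural number with 0 < x + k; at the poles 0, -1, -2, ... the
   division by zero gives the value 0. *)
Definition Gamma (R : realType) (x : R) : R :=
  if 0 < x then Gamma_integral x
  else let k := (Num.truncn (- x)).+1 in
       Gamma_integral (x + k%:R) / \prod_(i < k) (x + i%:R).

Definition rising (R : realType) (t alpha : R) : R :=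
  if t == 0 then 0 else Gamma (t + alpha) / Gamma t.

(* A sum from s = x to s = y with real bounds ranges over the finite set
   {x, x + 1, ...} `&` {y, y - 1, ...}; it is empty, for instance, when
   y = x - 1. The operators below are meant for 0 <= beta. *)
Definition nabla_left_sum (R : realType) (c beta : R) (h : R -> R) (t : R) : R :=
  if beta == 0 then h t else
  (Gamma beta)^-1 *
    \sum_(s \in upN (c + 1) `&` downN t) (rising (t - rho s) (beta - 1) * h s).

Definition nabla_right_sum (R : realType) (d beta : R) (h : R -> R) (t : R) : R :=
  if beta == 0 then h t else
  (Gamma beta)^-1 *
    \sum_(s \in upN t `&` downN (d - 1)) (rising (s - rho t) (beta - 1) * h s).

(* In both Caputo differences n is the integer with n - 1 < alpha <= n, and
   the base point is the subscript of the operator: c = a(alpha) = a + n - 1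
   for functions on {a, a + 1, ...}, and d = b(alpha) = b - n + 1 for functions
   on {b, b - 1, ...}. *)
Definition caputo_left (R : realType) (n : nat) (alpha c : R) (f : R -> R) :
    R -> R :=
  nabla_left_sum c (n%:R - alpha) (iter n (@nabla R) f).

Definition caputo_right (R : realType) (n : nat) (alpha d : R) (f : R -> R) :
    R -> R :=
  nabla_right_sum d (n%:R - alpha) (ominus_Delta n f).

(* Main.v *)
Require Import Defs.
From mathcomp Require Import all_boot all_order all_algebra.
From mathcomp Require Import all_classical all_reals all_analysis.
From mathcomp Require Import ring lra.

Local Open Scope classical_set_scope.
Local Open Scope ring_scope.

Import GRing.Theory Num.Theory.

(** The reflection [s |-> - s] exchanges upward and downward grids and turns backward differences
    into forward ones, the sign [(-1) ^+ n] absorbing the reversal. The kernel depends only on the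
    distance between [s] and [t], so it is preserved. The two sums therefore agree term by term
    after reindexing by [set_bij_oppr], with [caputo_summand_dual] matching the differences. *)

Lemma oppr_upN (R : realType) (a t : R) : upN a (- t) <-> downN (- a) t.
Proof. by split=> -[k e]; exists k; lra. Qed.

Lemma oppr_downN (R : realType) (b t : R) : downN b (- t) <-> upN (- b) t.
Proof. by split=> -[k e]; exists k; lra. Qed.

Lemma set_bij_oppr (R : realType) (x y : R) :
  set_bij (upN (- y) `&` downN (- x)) (upN x `&` downN y) -%R.
Proof.
split=> [s [/oppr_downN ? /oppr_upN ?]|r s _ _ /oppr_inj //|s [hx hy]] //.
by exists (- s); rewrite ?opprK //; split; [apply/oppr_downN|apply/oppr_upN];
  rewrite opprK.
Qed.

(** Each factor [- Delta] sends [g] to [g u - g (u + 1)], which is [nabla] of [f] read at [- u].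
    Duality is assumed only at the [m + 1] points that the [m]-th difference reads. *)
Lemma ominus_Delta_dual (R : realType) (m : nat) (f g : R -> R) (u : R) :
    (forall i, (i <= m)%N -> g (u + i%:R) = f (- (u + i%:R))) ->
  ominus_Delta m g u = iter m (@nabla R) f (- u).
Proof.
rewrite /ominus_Delta; elim: m u => [|m IHm] u gf.
  by have := gf 0 (leqnn 0); rewrite addr0 expr0 mul1r.
rewrite !iterS /Delta /nabla exprS -(IHm u) => [|i im]; last first.
  exact/gf/leqW.
rewrite -opprD -(IHm (u + 1)) => [|i im]; first by ring.
by have := gf i.+1 im; rewrite -natr1 [i%:R + 1]addrC addrA.
Qed.

Lemma caputo_summand_dual (R : realType) (a b : R) (f fs : R -> R) (n : nat)
    (s : R) :
    symmetric_dual a b f fs -> (upN (a + n%:R) `&` downN b) s ->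
  ominus_Delta n fs (- s) = iter n (@nabla R) f s.
Proof.
move=> hfs [[k sa] [j sb]]; rewrite -{2}(opprK s).
apply: ominus_Delta_dual => i ilen; apply: hfs; split.
  (* From [s = a + n + k = b - j]: [- s + i] is [- b + (j + i)] and also [- a - (k + (n - i))]. *)
  by exists (j + i)%N; rewrite natrD; lra.
by exists (k + (n - i))%N; rewrite natrD natrB //; lra.
Qed.

Theorem theorem24 (R : realType) (a b : R) (f fs : R -> R)
    (hfs : symmetric_dual a b f fs)
    (n : nat) (hn : (1 <= n)%N)
    (alpha : R) (halpha1 : n%:R - 1 < alpha) (halpha2 : alpha <= n%:R)
    (a_alpha : R) (ha_alpha : a_alpha = a + n%:R - 1)
    (t : R) (ht : (upN (a + n%:R) `&` downN b) t) :
  caputo_left n alpha a_alpha f t = caputo_right n alpha (- a_alpha) fs (- t).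
Proof.
rewrite /caputo_left /caputo_right /nabla_left_sum /nabla_right_sum.
(* If [alpha = n], both sums are the identity and only the summand at [t] remains. *)
case: ifP => _; first by rewrite (caputo_summand_dual _ _ _ _ _ _ _ hfs).
congr (_ * _).
rewrite ha_alpha subrK (reindex_fsbig _ _ _ _ (set_bij_oppr _ (a + n%:R) t)).
have -> : - (a + n%:R - 1) - 1 = - (a + n%:R) by ring.
apply: eq_fsbigr => s; rewrite inE => -[/oppr_downN st /oppr_upN sa].
(* Both kernel arguments equal [t + s + 1]. *)
congr (rising _ _ * _); first by rewrite /rho; ring.
rewrite -{2}(opprK s) (caputo_summand_dual _ _ _ _ _ _ _ hfs) //; split=> //.
(* The reflected point [- s] stays below [b] because it is at most [t]. *)
by case: ht st => _ [i ti] [j sj]; exists (i + j)%N; rewrite natrD; lra.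
Qed.
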